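(* Consider the Rescaled Pólya urn with $k\ge2$ colors and parameters $\alpha>0$ and $\beta>1$. Then, as $N\to\infty$, $$\boldsymbol{\psi}_N\ \longrightarrow\ \boldsymbol{\psi}_\infty=\frac{\boldsymbol{B}_0+\alpha\sum_{n=1}^{+\infty}\beta^{-n}\boldsymbol{\xi}_n}{|\boldsymbol{B}_0|+\frac{\alpha}{\beta-1}}\qquad\text{almost surely},$$ and $|\boldsymbol{\psi}_N-\boldsymbol{\psi}_\infty|=O(\beta^{-N})$. Moreover, $\boldsymbol{\psi}_\infty$ takes values in $\{\boldsymbol{x}\in[0,1]^k:\ |\boldsymbol{x}|=1\}$ and, if $B_{0,i}>0$ for all $i=1,\dots,k$, then $P\{\psi_{\infty,i}\in(0,1)\}=1$ for each $i$.
   Context: For $x\in\mathbb{R}^k$, $|x|=\sum_{i=1}^k|x_i|$; $e_1,\dots,e_k$ is the canonical basis of $\mathbb{R}^k$. Rescaled Pólya (RP) urn with $k$ colors and parameters $\alpha,\beta$: let $\boldsymbol{b}_0=(b_{0,1},\dots,b_{0,k})^\top$ and $\boldsymbol{B}_0=(B_{0,1},\dots,B_{0,k})^\top$ be deterministic vectors with nonnegative real entries such that $|\boldsymbol{b}_0|>0$ and $b_{0,i}+B_{0,i}>0$ for every $i$. The draws $\boldsymbol{\xi}_n=(\xi_{n,1},\dots,\xi_{n,k})^\top$, $n\ge1$, are random vectors with values in $\{e_1,\dots,e_k\}$. Set $\boldsymbol{B}_{n}=\beta\boldsymbol{B}_{n-1}+\alpha\boldsymbol{\xi}_{n}$ for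 $n\ge1$, and $\boldsymbol{N}_n=\boldsymbol{b}_0+\boldsymbol{B}_n$ for $n\ge0$. With $\mathcal{F}_0$ trivial and $\mathcal{F}_n=\sigma(\boldsymbol{\xi}_1,\dots,\boldsymbol{\xi}_n)$, the law of the draws is determined by $$P(\xi_{n+1,i}=1\mid\mathcal{F}_n)=\psi_{n,i},\qquad \boldsymbol{\psi}_n=\frac{\boldsymbol{N}_n}{|\boldsymbol{N}_n|}=\frac{\boldsymbol{b}_0+\boldsymbol{B}_n}{|\boldsymbol{b}_0|+|\boldsymbol{B}_n|},\qquad n\ge0.$$ *)

(* Defs.v *)
From mathcomp Require Import all_boot all_order all_algebra.
From mathcomp Require Import all_classical all_reals all_analysis.
Set Implicit Arguments.
Unset Strict Implicit.
Unset Printing Implicit Defensive.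
Import Order.TTheory GRing.Theory Num.Theory.
Import numFieldNormedType.Exports.
Local Open Scope classical_set_scope.
Local Open Scope ring_scope.

(* The library norm `|x| on matrices is the max norm, hence this definition. *)
Definition norm1 (R : realType) (k : nat) (x : 'cV[R]_k) : R :=
  \sum_(i < k) `|x i 0|.

(* [Y] is a version of the conditional probability P(E | G). *)
Definition is_cond_prob (R : realType) (d : measure_display)
    (T : measurableType d) (P : probability T R)
    (G : set (set T)) (E : set T) (Y : T -> R) : Prop :=
  [/\ forall U : set R, measurable U -> G (Y @^-1` U),
      P.-integrable setT (EFin \o Y) &
      forall A : set T, G A -> (\int[P]_(w in A) (Y w)%:E = P (A `&` E))%E].

Section RescaledPolya.
Context (R : realType) (d : measure_display) (T : measurableType d).
Context (k : nat) (alpha beta : R) (b0 B0 : 'cV[R]_k).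
(* The draws are xi 1, xi 2, ...; xi 0 is never used. *)
Variable xi : nat -> T -> 'cV[R]_k.

Fixpoint rpB (n : nat) (w : T) : 'cV[R]_k :=
  if n is m.+1 then beta *: rpB m w + alpha *: xi m.+1 w else B0.

Definition rpN (n : nat) (w : T) : 'cV[R]_k := b0 + rpB n w.

Definition rppsi (n : nat) (w : T) : 'cV[R]_k :=
  (norm1 (rpN n w))^-1 *: rpN n w.

Definition rpF (n : nat) : set (set T) :=
  <<s \bigcup_(m in [set m | (1 <= m <= n)%N])
        \bigcup_(i in [set: 'I_k])
          preimage_set_system setT (fun w => xi m w i 0) measurable >>.

Record rescaled_polya (P : probability T R) : Prop := {
  rp_b0_ge0 : forall i, 0 <= b0 i 0;
  rp_B0_ge0 : forall i, 0 <= B0 i 0;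
  rp_b0_gt0 : 0 < norm1 b0;
  rp_bB_gt0 : forall i, 0 < b0 i 0 + B0 i 0;
  rp_xi_basis : forall n w, (1 <= n)%N -> exists i, xi n w = delta_mx i 0;
  rp_xi_meas : forall n i, (1 <= n)%N ->
    measurable_fun setT (fun w => xi n w i 0);
  rp_law : forall n i,
    is_cond_prob P (rpF n) [set w | xi n.+1 w i 0 = 1]
      (fun w => rppsi n w i 0)
}.

Definition rppsi_oo (w : T) : 'cV[R]_k :=
  (norm1 B0 + alpha / (beta - 1))^-1 *:
    (B0 + alpha *: limn (fun m => \sum_(1 <= n < m) (beta ^- n *: xi n w))).

End RescaledPolya.

(* Main.v *)
Require Import Defs.
From mathcomp Require Import all_boot all_order all_algebra.
From mathcomp Require Import all_classical all_reals all_analysis.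
From mathcomp Require Import ring lra.
Import Order.TTheory GRing.Theory Num.Theory.
Import numFieldNormedType.Exports.
Local Open Scope classical_set_scope.
Local Open Scope ring_scope.

(** The argument is pathwise: everything is proved for an arbitrary sequence of
basis vectors in place of the draws, with constants independent of it.

Unrolling the recursion, [B_n = beta^n (B_0 + alpha S_n)] with
[S_n = sum_(1 <= m <= n) beta^-m xi_m].  Since the entries of the draws are
nonnegative and sum to one, [S_n] increases coordinatewise and has l1 norm
[(1 - beta^-n) / (beta - 1)]; hence it has a limit [S], of norm
[1 / (beta - 1)], and [|S - S_n| = beta^-n / (beta - 1)].  Put
[M = B_0 + alpha S].  Then [psi_oo] is [M] normalized, as
[|M| = |B_0| + alpha / (beta - 1)], and [N_n] differs from [beta^n M] only by
[b_0 - beta^n alpha (S - S_n)], which stays bounded ([rpN_error]), while [|N_n|]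
grows at least like [beta^n] ([norm1_rpN_ge]).  Normalizing divides the error by
[|N_n|] up to a factor 2 ([norm1_normalizeB]), so
[|psi_n - psi_oo| = O(beta^-n)] with a constant that does not depend on the
outcome ([rppsi_dist]), and convergence follows.

As a normalized nonnegative vector, [psi_oo] lies in the simplex.  Because
[M >= B_0], if all entries of [B_0] are positive then so are those of [psi_oo];
they sum to one and there are at least two of them, so each is below one. *)

Set Implicit Arguments.
Unset Strict Implicit.

(** * The l1 norm and normalization *)

Section Norm1.
Context {R : realType} {k : nat}.
Implicit Types (x y : 'cV[R]_k) (c : R).

Lemma norm1_ge0 x : 0 <= norm1 x.
Proof. by apply: sumr_ge0 => i _; exact: normr_ge0. Qed.

Lemma ler_norm1D x y : norm1 (x + y) <= norm1 x + norm1 y.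
Proof.
by rewrite /norm1 -big_split; apply: ler_sum => i _; rewrite mxE ler_normD.
Qed.

Lemma norm1Z c x : norm1 (c *: x) = `|c| * norm1 x.
Proof.
by rewrite /norm1 mulr_sumr; apply: eq_bigr => i _; rewrite mxE normrM.
Qed.

Lemma norm1N x : norm1 (- x) = norm1 x.
Proof. by rewrite -scaleN1r norm1Z normrN1 mul1r. Qed.

Lemma norm1_delta (i : 'I_k) : norm1 (delta_mx i 0 : 'cV[R]_k) = 1.
Proof.
rewrite /norm1 (bigD1 i) //= mxE !eqxx normr1 big1 ?addr0 // => j /negPf ji.
by rewrite mxE ji normr0.
Qed.

Lemma norm1_nonneg x : (forall i, 0 <= x i 0) -> norm1 x = \sum_i x i 0.
Proof. by move=> x0; apply: eq_bigr => i _; rewrite ger0_norm. Qed.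

Lemma norm1D_nonneg x y : (forall i, 0 <= x i 0) -> (forall i, 0 <= y i 0) ->
  norm1 (x + y) = norm1 x + norm1 y.
Proof.
move=> x0 y0; rewrite !norm1_nonneg // => [|i]; last by rewrite mxE addr_ge0.
by rewrite -big_split; apply: eq_bigr => i _; rewrite mxE.
Qed.

Lemma mx_norm_le_norm1 x : `|x| <= norm1 x.
Proof.
rewrite [leLHS]/Num.Def.normr /= mx_normrE.
apply: bigmax_le => [|[i j] _] /=; first exact: norm1_ge0.
by rewrite (ord1 j) /norm1 (bigD1 i) //= lerDl sumr_ge0.
Qed.

Lemma coord_le_norm1 x i : (forall i, 0 <= x i 0) -> x i 0 <= norm1 x.
Proof.
by move=> x0; rewrite norm1_nonneg // (bigD1 i) //= lerDl sumr_ge0.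
Qed.

Lemma coord_lt_norm1 x i j :
  (forall i, 0 <= x i 0) -> j != i -> 0 < x j 0 -> x i 0 < norm1 x.
Proof.
move=> x0 ji xj; rewrite norm1_nonneg // (bigD1 i) //= ltrDl (bigD1 j) //=.
by rewrite ltr_wpDr // sumr_ge0.
Qed.

Definition normalize x : 'cV[R]_k := (norm1 x)^-1 *: x.

Lemma norm1_normalize x : 0 < norm1 x -> norm1 (normalize x) = 1.
Proof.
by move=> x0; rewrite norm1Z ger0_norm ?invr_ge0 ?ltW // mulVf ?gt_eqF.
Qed.

Lemma normalizeZ c x : 0 < c -> normalize (c *: x) = normalize x.
Proof.
move=> c0; rewrite /normalize norm1Z gtr0_norm // scalerA invfM.
by rewrite mulrAC mulVf ?gt_eqF // mul1r.
Qed.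

(** Write [x/|x| - y/|y| = ((x - y) + (|y| - |x|) y/|y|) / |x|]: both terms of
the numerator have norm at most [|x - y|], the second by the reverse triangle
inequality.  Only one of the two norms appears in the bound, which lets [y] be
rescaled to be close to [x]. *)
Lemma norm1_normalizeB x y : 0 < norm1 x -> 0 < norm1 y ->
  norm1 (normalize x - normalize y) <= 2 * norm1 (x - y) / norm1 x.
Proof.
move=> x0 y0.
have -> : normalize x - normalize y =
  (norm1 x)^-1 *: ((x - y) + (norm1 y - norm1 x) *: normalize y).
  apply/matrixP => i j; rewrite /normalize !mxE.
  by field; rewrite !gt_eqF.
rewrite norm1Z gtr0_norm ?invr_gt0 // mulrC ler_pM2r ?invr_gt0 //.
apply: le_trans (ler_norm1D _ _) _.
rewrite norm1Z norm1_normalize // mulr1 mulr2n mulrDl mul1r lerD2l.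
have xy := ler_norm1D (x - y) y; rewrite subrK in xy.
have yx := ler_norm1D (y - x) x; rewrite subrK -opprB norm1N in yx.
rewrite ler_norml; lra.
Qed.

Lemma cvg_col_coord (u : nat -> 'cV[R]_k) (l : 'cV[R]_k) :
  (forall i, u n i 0 @[n --> \oo] --> l i 0) -> u n @[n --> \oo] --> l.
Proof.
move=> ul; apply/cvg_mx_entourageP => A entA.
have /filter_forall : forall i : 'I_k,
    \forall n \near \oo, (l i 0, u n i 0) \in A.
  by move=> i; move/cvg_app_entourageP: (ul i) => /(_ A entA);
    apply: filterS => n ?; rewrite inE.
by apply: filterS => n An i j; rewrite (ord1 j).
Qed.

Lemma cvg_coord (u : nat -> 'cV[R]_k) (l : 'cV[R]_k) i :
  u n @[n --> \oo] --> l -> u n i 0 @[n --> \oo] --> l i 0.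
Proof.
by move=> ul; exact: (cvg_comp _ _ ul (@coord_continuous _ _ _ i 0 l)).
Qed.

Lemma cvg_norm1 (u : nat -> 'cV[R]_k) (l : 'cV[R]_k) :
  u n @[n --> \oo] --> l -> norm1 (u n) @[n --> \oo] --> norm1 l.
Proof.
move=> ul; apply: (cvg_big add_continuous) => i _.
by apply: cvg_norm; exact: cvg_coord.
Qed.

Lemma cvg_norm1_dist (u : nat -> 'cV[R]_k) (l : 'cV[R]_k) (v : nat -> R) :
  (\forall n \near \oo, norm1 (u n - l) <= v n) -> v n @[n --> \oo] --> 0 ->
  u n @[n --> \oo] --> l.
Proof.
move=> uv v0; apply/subr_cvg0; apply: norm_cvg0.
apply: (squeeze_cvgr _ (cvg_cst 0) v0); apply: filterS uv => n uv.
by rewrite normr_ge0 (le_trans (mx_norm_le_norm1 _)).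
Qed.

End Norm1.

(** * Discounted sums of basis vectors *)

Section DiscountedDraws.
Context {R : realType} {k : nat}.
Variable beta : R.
Hypothesis beta1 : 1 < beta.
Variable x : nat -> 'cV[R]_k.
Hypothesis xP : forall n, (1 <= n)%N -> exists i, x n = delta_mx i 0.

Definition discounted_sum (m : nat) : 'cV[R]_k :=
  \sum_(1 <= n < m) (beta ^- n *: x n).

Let beta0 : 0 < beta. Proof. exact: lt_trans beta1. Qed.

Lemma draw_ge0 n i : (1 <= n)%N -> 0 <= x n i 0.
Proof. by move=> /xP[j ->]; rewrite mxE ler0n. Qed.

Lemma discounted_sum_incr_ge0 m n i : (1 <= m <= n)%N ->
  0 <= discounted_sum n i 0 - discounted_sum m i 0.
Proof.
move=> /andP[m1 mn]; rewrite /discounted_sum (big_cat_nat m1 mn) /=.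
rewrite mxE addrAC subrr add0r summxE big_nat sumr_ge0 // => l /andP[ml _].
by rewrite mxE mulr_ge0 ?invr_ge0 ?exprn_ge0 ?draw_ge0 ?ltW ?(leq_trans m1).
Qed.

Lemma discounted_sum1 : discounted_sum 1 = 0.
Proof. by rewrite /discounted_sum big_geq. Qed.

Lemma discounted_sum_ge0 n i : 0 <= discounted_sum n.+1 i 0.
Proof.
have := @discounted_sum_incr_ge0 1 n.+1 i isT.
by rewrite discounted_sum1 mxE subr0.
Qed.

Lemma discounted_sumS n :
  discounted_sum n.+2 = discounted_sum n.+1 + beta ^- n.+1 *: x n.+1.
Proof. by rewrite /discounted_sum big_nat_recr. Qed.

(** On nonnegative vectors the l1 norm is additive, so the norm of the partial
sum is the partial sum of the geometric series, whatever the draws are. *)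
Lemma norm1_discounted_sum n :
  norm1 (discounted_sum n.+1) = (1 - beta ^- n) / (beta - 1).
Proof.
elim: n => [|n ih].
  by rewrite discounted_sum1 -(scale0r 0) norm1Z normr0 mul0r expr0 invr1
    subrr mul0r.
rewrite discounted_sumS norm1D_nonneg; last 2 first.
- exact: discounted_sum_ge0.
- by move=> i; rewrite mxE mulr_ge0 ?invr_ge0 ?exprn_ge0 ?draw_ge0 ?ltW.
have [j ->] := @xP n.+1 isT.
rewrite norm1Z norm1_delta gtr0_norm ?invr_gt0 ?exprn_gt0 // ih exprS.
by field; rewrite ?expf_neq0 ?gt_eqF ?subr_gt0.
Qed.

(** Each coordinate is nondecreasing, and bounded by the norm. *)
Lemma cvg_discounted_sum : cvgn discounted_sum.
Proof.
apply: (cvgP (\col_i limn (fun m => discounted_sum m.+1 i 0))).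
rewrite -cvg_shiftS; apply: cvg_col_coord => i; rewrite mxE.
apply: nondecreasing_is_cvgn => [m n mn|].
  by rewrite -subr_ge0 discounted_sum_incr_ge0.
exists (beta - 1)^-1 => _ [n _ <-].
apply: le_trans (coord_le_norm1 i (discounted_sum_ge0 n)) _.
rewrite norm1_discounted_sum ler_piMl //.
  by rewrite invr_ge0 subr_ge0 ltW.
by rewrite gerBl invr_ge0 exprn_ge0 // ltW.
Qed.

Lemma discounted_tail_ge0 n i :
  0 <= (limn discounted_sum - discounted_sum n.+1) i 0.
Proof.
have coord := cvg_coord (i := i) cvg_discounted_sum.
rewrite !mxE subr_ge0 -(cvg_lim _ coord) //.
apply: limr_ge; first exact: cvgP coord.
near=> m; rewrite /= -subr_ge0 discounted_sum_incr_ge0 //=.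
by near: m; exists n.+1.
Unshelve. all: by end_near. Qed.

Lemma discounted_lim_ge0 i : 0 <= limn discounted_sum i 0.
Proof. by have := discounted_tail_ge0 0 i; rewrite discounted_sum1 subr0. Qed.

Lemma norm1_discounted_lim : norm1 (limn discounted_sum) = (beta - 1)^-1.
Proof.
have := cvg_norm1 cvg_discounted_sum; rewrite -cvg_shiftS.
under eq_fun do rewrite norm1_discounted_sum -exprVn.
move=> norm_lim; rewrite -(cvg_lim _ norm_lim) //; apply/cvg_lim => //.
rewrite -[X in _ --> X]mul1r -[X in X * _]subr0.
apply: cvgMr_tmp; apply: cvgB; first exact: cvg_cst.
by apply: cvg_expr; rewrite gtr0_norm ?invr_gt0 ?invf_lt1.
Qed.

(** The tail and the partial sum are both nonnegative, so their norms add up to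
the norm of the limit. *)
Lemma norm1_discounted_tail n :
  norm1 (limn discounted_sum - discounted_sum n.+1) = beta ^- n / (beta - 1).
Proof.
have := norm1D_nonneg (discounted_tail_ge0 n) (discounted_sum_ge0 n).
rewrite subrK norm1_discounted_lim norm1_discounted_sum => e.
by rewrite -[LHS](addrK ((1 - beta ^- n) / (beta - 1))) -e; ring.
Qed.

End DiscountedDraws.

(** * The urn along one sequence of draws *)

Section RescaledPolyaPath.
Context {R : realType} {d : measure_display} {T : measurableType d} {k : nat}.
Variables (alpha beta : R) (b0 B0 : 'cV[R]_k) (xi : nat -> T -> 'cV[R]_k).
Variable w : T.
Hypotheses (alpha0 : 0 < alpha) (beta1 : 1 < beta).
Hypotheses (b0_ge0 : forall i, 0 <= b0 i 0) (B0_ge0 : forall i, 0 <= B0 i 0).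
Hypothesis xiP : forall n, (1 <= n)%N -> exists i, xi n w = delta_mx i 0.

Let beta0 : 0 < beta. Proof. exact: lt_trans beta1. Qed.

Let disc := discounted_sum beta (xi^~ w).

(** The limit of [beta^-n N_n]. *)
Definition rp_limit : 'cV[R]_k := B0 + alpha *: limn disc.

Lemma rpB_discounted n :
  rpB alpha beta B0 xi n w = beta ^+ n *: (B0 + alpha *: disc n.+1).
Proof.
elim: n => [|n /= ->].
  by rewrite /disc discounted_sum1 scaler0 addr0 scale1r.
rewrite /disc discounted_sumS; apply/matrixP => i j; rewrite !mxE !exprS.
by field; rewrite ?expf_neq0 ?gt_eqF.
Qed.

Lemma rp_limit_ge i : B0 i 0 <= rp_limit i 0.
Proof.
rewrite !mxE lerDl mulr_ge0 //; first exact: ltW.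
exact: (discounted_lim_ge0 beta1 xiP i).
Qed.

Lemma rp_limit_ge0 i : 0 <= rp_limit i 0.
Proof. exact: le_trans (rp_limit_ge i). Qed.

Lemma norm1_rp_limit : norm1 rp_limit = norm1 B0 + alpha / (beta - 1).
Proof.
rewrite norm1D_nonneg // => [|i].
  by rewrite norm1Z gtr0_norm // (norm1_discounted_lim beta1 xiP).
rewrite mxE mulr_ge0 //; first exact: ltW.
exact: (discounted_lim_ge0 beta1 xiP i).
Qed.

Lemma norm1_rp_limit_gt0 : 0 < norm1 rp_limit.
Proof.
by rewrite norm1_rp_limit ltr_wpDl ?norm1_ge0 // divr_gt0 ?subr_gt0.
Qed.

Lemma rppsi_ooE : rppsi_oo alpha beta B0 xi w = normalize rp_limit.
Proof. by rewrite /normalize norm1_rp_limit. Qed.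

(** The factor [beta^n] in front of [alpha (S - S_n)] is compensated exactly by
the geometric decay of the tail. *)
Lemma rpN_error n :
  norm1 (rpN alpha beta b0 B0 xi n w - beta ^+ n *: rp_limit) <=
  norm1 b0 + alpha / (beta - 1).
Proof.
have -> : rpN alpha beta b0 B0 xi n w - beta ^+ n *: rp_limit =
    b0 - (beta ^+ n * alpha) *: (limn disc - disc n.+1).
  by rewrite /rpN rpB_discounted; apply/matrixP => i j; rewrite !mxE; ring.
apply: le_trans (ler_norm1D _ _) _; rewrite lerD2l norm1N norm1Z.
rewrite (norm1_discounted_tail beta1 xiP) gtr0_norm ?mulr_gt0 ?exprn_gt0 //.
by rewrite [_ * alpha]mulrC -mulrA mulVKf // expf_neq0 // gt_eqF.
Qed.

(** The first draw alone contributes [alpha beta^(n-1)] to [|B_n|]; at [n = 0]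
no draw has been made yet. *)
Lemma norm1_rpN_ge n : (1 <= n)%N ->
  alpha / beta * beta ^+ n <= norm1 (rpN alpha beta b0 B0 xi n w).
Proof.
move=> n1; have bn0 : 0 < beta ^+ n by rewrite exprn_gt0.
have S_ge0 i : 0 <= disc n.+1 i 0 by exact: discounted_sum_ge0.
have aS_ge0 i : 0 <= (alpha *: disc n.+1) i 0 by rewrite mxE mulr_ge0 // ltW.
rewrite /rpN rpB_discounted norm1D_nonneg // => [|i]; last first.
  by rewrite mxE mulr_ge0 ?(ltW bn0) // mxE addr_ge0.
apply: (@le_trans _ _ (beta ^+ n * (alpha * norm1 (disc n.+1)))).
  (* [|S_n| >= 1 / beta], which by the closed form is [beta^-n <= beta^-1]. *)
  rewrite mulrC ler_pM2l // ler_pM2l // (norm1_discounted_sum beta1 xiP).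
  rewrite ler_pdivlMr ?subr_gt0 // mulrBr mulVf ?gt_eqF // mulr1 lerB //.
  by rewrite lef_pV2 ?posrE // -[leLHS]expr1 ler_eXn2l.
rewrite norm1Z norm1D_nonneg // norm1Z !gtr0_norm // mulrDr addrA lerDr.
by rewrite addr_ge0 ?mulr_ge0 ?norm1_ge0 ?ltW.
Qed.

(** Compares [N_n] with [beta^n M], which has the same normalization as [M]. *)
Lemma rppsi_dist n : (1 <= n)%N ->
  norm1 (rppsi alpha beta b0 B0 xi n w - rppsi_oo alpha beta B0 xi w) <=
  2 * (norm1 b0 + alpha / (beta - 1)) * (beta / alpha) * beta ^- n.
Proof.
move=> n1; have bn0 : 0 < beta ^+ n by rewrite exprn_gt0.
have lb0 : 0 < alpha / beta * beta ^+ n by rewrite mulr_gt0 ?divr_gt0.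
have N_ge := norm1_rpN_ge n1; have N_gt0 := lt_le_trans lb0 N_ge.
rewrite rppsi_ooE -(normalizeZ _ bn0).
apply: le_trans (norm1_normalizeB N_gt0 _) _.
  by rewrite norm1Z gtr0_norm // mulr_gt0 // norm1_rp_limit_gt0.
rewrite -[leRHS]mulrA.
have -> : beta / alpha * beta ^- n = (alpha / beta * beta ^+ n)^-1.
  by rewrite invfM invf_div.
apply: ler_pM => //.
- by rewrite mulr_ge0 ?norm1_ge0.
- by rewrite invr_ge0 ltW.
- by rewrite ler_pM2l ?rpN_error.
- by rewrite lef_pV2.
Qed.

End RescaledPolyaPath.

Unset Implicit Arguments.
Set Strict Implicit.

Theorem theorem3p5 (R : realType) (d : measure_display) (T : measurableType d)
    (P : probability T R) (k : nat) (alpha beta : R) (b0 B0 : 'cV[R]_k)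
    (xi : nat -> T -> 'cV[R]_k)
    (hk : (2 <= k)%N) (halpha : 0 < alpha) (hbeta : 1 < beta)
    (hRP : rescaled_polya alpha beta b0 B0 xi P) :
  [/\ {ae P, forall w, rppsi alpha beta b0 B0 xi N w @[N --> \oo]
                         --> rppsi_oo alpha beta B0 xi w},
      (exists C : R, \forall N \near \oo, forall w,
         norm1 (rppsi alpha beta b0 B0 xi N w - rppsi_oo alpha beta B0 xi w)
           <= C * beta ^- N),
      (forall w, (forall i, 0 <= rppsi_oo alpha beta B0 xi w i 0 <= 1) /\
                 norm1 (rppsi_oo alpha beta B0 xi w) = 1) &
      ((forall i, 0 < B0 i 0) ->
        forall i, P [set w | 0 < rppsi_oo alpha beta B0 xi w i 0 < 1] = 1%E)].
Proof.
have [b0_ge0 B0_ge0 _ _ basis _ _] := hRP.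
have xiP w n : (1 <= n)%N -> exists i, xi n w = delta_mx i 0 by exact: basis.
have lim_gt0 w : 0 < norm1 (rp_limit alpha beta B0 xi w).
  exact: (norm1_rp_limit_gt0 halpha hbeta B0_ge0 (xiP w)).
have lim_ge0 w i : 0 <= rp_limit alpha beta B0 xi w i 0.
  exact: (rp_limit_ge0 halpha hbeta B0_ge0 (xiP w)).
have psi_ooE w : rppsi_oo alpha beta B0 xi w =
    normalize (rp_limit alpha beta B0 xi w).
  exact: (rppsi_ooE halpha hbeta B0_ge0 (xiP w)).
have dist n w := @rppsi_dist _ _ _ _ _ _ _ _ _ w
  halpha hbeta b0_ge0 B0_ge0 (xiP w) n.
have psi_oo_ge0 w i : 0 <= rppsi_oo alpha beta B0 xi w i 0.
  by rewrite psi_ooE mxE mulr_ge0 // invr_ge0 ltW.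
have norm1_psi_oo w : norm1 (rppsi_oo alpha beta B0 xi w) = 1.
  by rewrite psi_ooE norm1_normalize.
split.
- apply/aeW => w.
  pose C := 2 * (norm1 b0 + alpha / (beta - 1)) * (beta / alpha).
  apply: (@cvg_norm1_dist _ _ _ _ (fun n => C * beta^-1 ^+ n)).
    by exists 1%N => // n n1; rewrite exprVn; exact: dist.
  apply: cvg_geometric.
  by rewrite gtr0_norm ?invr_gt0 ?invf_lt1 // (lt_trans _ hbeta).
- exists (2 * (norm1 b0 + alpha / (beta - 1)) * (beta / alpha)).
  by exists 1%N => // n n1 w; exact: dist.
- move=> w; split=> // i; rewrite psi_oo_ge0 /= -(norm1_psi_oo w).
  exact: coord_le_norm1.
- move=> B0_gt0 i; rewrite -(@probability_setT _ _ _ P); congr (P _).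
  apply/seteqP; split=> // w _ /=.
  have psi_oo_gt0 j : 0 < rppsi_oo alpha beta B0 xi w j 0.
    rewrite psi_ooE mxE mulr_gt0 ?invr_gt0 //.
    apply: lt_le_trans (B0_gt0 j) _.
    exact: (rp_limit_ge _ halpha hbeta (xiP w)).
  have [j ji] : exists j : 'I_k, j != i.
    case: (eqVneq i (Ordinal (ltnW hk))) => [->|ine].
      by exists (Ordinal hk).
    by exists (Ordinal (ltnW hk)); rewrite eq_sym.
  rewrite psi_oo_gt0 /= -(norm1_psi_oo w).
  exact: (@coord_lt_norm1 _ _ _ _ j).
Qed.
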